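(* Let $M,N\ge1$ be integers, $P,\sigma^2,\beta_1,\beta_2,\alpha_{\rm A\text{-}RIS}>0$, and $\alpha_{\rm NCR}\ge0$. Define $$\mathrm{SNR}_{\rm NCR}=\frac{\alpha_{\rm NCR}^2PM\beta_1\beta_2}{\sigma^2(1+\alpha_{\rm NCR}^2\beta_2M)},\qquad \mathrm{SNR}_{\rm A\text{-}RIS}=\frac{\alpha_{\rm A\text{-}RIS}^2P\beta_1\beta_2N^2M}{\sigma^2(1+\alpha_{\rm A\text{-}RIS}^2\beta_2MN)}.$$ If $1-(N^2-N)\alpha_{\rm A\text{-}RIS}^2M\beta_2>0$, then $$\mathrm{SNR}_{\rm NCR}\ge\mathrm{SNR}_{\rm A\text{-}RIS}\iff\alpha_{\rm NCR}\ge\frac{\alpha_{\rm A\text{-}RIS}N}{\sqrt{1-(N^2-N)\alpha_{\rm A\text{-}RIS}^2M\beta_2}}.$$ If $(N^2-N)\alpha_{\rm A\text{-}RIS}^2M\beta_2\ge1$, then $\mathrm{SNR}_{\rm A\text{-}RIS}>\mathrm{SNR}_{\rm NCR}$ for every $\alpha_{\rm NCR}\ge0$.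
   Context: $\mathrm{SNR}_{\rm NCR}$ and $\mathrm{SNR}_{\rm A\text{-}RIS}$ are the maximal uplink signal-to-noise ratios (no direct user–base-station link) with, respectively, a network-controlled repeater of amplification gain $\alpha_{\rm NCR}$ and an active RIS with $N$ elements and per-element gain $\alpha_{\rm A\text{-}RIS}$; $M$ is the number of base station antennas. *)

(* Defs.v *)
From Stdlib Require Import Reals.
Local Open Scope R_scope.

(** [sigma2] stands for the noise variance $\sigma^2$ itself (it is not squared
    again); [alphaN] and [alphaA] are amplitude gains. *)
Definition SNR_NCR (M : nat) (P sigma2 beta1 beta2 alphaN : R) : R :=
  (alphaN ^ 2 * P * INR M * beta1 * beta2)
  / (sigma2 * (1 + alphaN ^ 2 * beta2 * INR M)).

Definition SNR_ARIS (M N : nat) (P sigma2 beta1 beta2 alphaA : R) : R :=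
  (alphaA ^ 2 * P * beta1 * beta2 * INR N ^ 2 * INR M)
  / (sigma2 * (1 + alphaA ^ 2 * beta2 * INR M * INR N)).

(* Main.v *)
Require Import Defs.
From Stdlib Require Import Reals Lra.
Local Open Scope R_scope.

(** Over the common denominator, [SNR_NCR - SNR_ARIS] is a positive multiple of
    [alphaN ^ 2 * D - (alphaA * N) ^ 2] with
    [D = 1 - (N ^ 2 - N) * alphaA ^ 2 * M * beta2]. For [D > 0] its sign is that of
    [alphaN * sqrt D - alphaA * N]; for [D <= 0] it is negative. *)

Lemma SNR_diff (M N : nat) (P sigma2 beta1 beta2 alphaN alphaA : R) :
  (1 <= M)%nat -> 0 < P -> 0 < sigma2 -> 0 < beta1 -> 0 < beta2 ->
  exists K, 0 < K /\
    SNR_NCR M P sigma2 beta1 beta2 alphaN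
      - SNR_ARIS M N P sigma2 beta1 beta2 alphaA
    = K * (alphaN ^ 2 * (1 - (INR N ^ 2 - INR N) * alphaA ^ 2 * INR M * beta2)
           - (alphaA * INR N) ^ 2).
Proof.
intros hM hP hs hb1 hb2.
assert (HM : 0 < INR M) by now apply lt_0_INR.
assert (HN : 0 <= INR N) by apply pos_INR.
assert (d1 : 0 < 1 + alphaN ^ 2 * beta2 * INR M).
{ assert (0 <= alphaN ^ 2 * beta2 * INR M); [|lra].
  pose proof (pow2_ge_0 alphaN); auto using Rmult_le_pos, Rlt_le. }
assert (d2 : 0 < 1 + alphaA ^ 2 * beta2 * INR M * INR N).
{ assert (0 <= alphaA ^ 2 * beta2 * INR M * INR N); [|lra].
  pose proof (pow2_ge_0 alphaA); auto 6 using Rmult_le_pos, Rlt_le. }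
(* The factor shared by both numerators, over the product of the two denominators with [sigma2]
   taken once. In the cross-multiplied numerators, the terms in [alphaN ^ 2 * alphaA ^ 2] combine
   into the coefficient [N - N ^ 2]. *)
exists (P * INR M * beta1 * beta2
  / (sigma2 * (1 + alphaN ^ 2 * beta2 * INR M)
     * (1 + alphaA ^ 2 * beta2 * INR M * INR N))).
split.
- apply Rdiv_lt_0_compat; repeat apply Rmult_lt_0_compat; assumption.
- unfold SNR_NCR, SNR_ARIS; field; repeat split; lra.
Qed.

(** Multiplying by [sqrt D > 0] reduces the left side to comparing [x * sqrt D] with [c]. Both are
    nonnegative, so squaring preserves and reflects their order. *)
Lemma Rge_div_sqrt (x c D : R) :
  0 <= x -> 0 <= c -> 0 < D -> (x >= c / sqrt D <-> 0 <= x ^ 2 * D - c ^ 2).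
Proof.
intros hx hc hD.
assert (hs : 0 < sqrt D) by now apply sqrt_lt_R0.
assert (E : x ^ 2 * D = (x * sqrt D) ^ 2).
{ rewrite Rpow_mult_distr, pow2_sqrt; lra. }
rewrite E.
assert (hxs : 0 <= x * sqrt D) by (apply Rmult_le_pos; lra).
assert (F : c / sqrt D * sqrt D = c) by (field; lra).
split; intro H.
- apply Rge_le, (Rmult_le_compat_r (sqrt D)) in H; [|lra].
  rewrite F in H.
  pose proof (pow_incr c (x * sqrt D) 2 (conj hc H)); lra.
- apply Rle_ge, (Rmult_le_reg_r (sqrt D)); [assumption|].
  rewrite F.
  apply Rsqr_incr_0; [rewrite !Rsqr_pow2; lra | lra | lra].
Qed.

Theorem mainTheorem7 (M N : nat) (P sigma2 beta1 beta2 alphaA : R)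
  (hM : (1 <= M)%nat) (hN : (1 <= N)%nat)
  (hP : 0 < P) (hsigma2 : 0 < sigma2)
  (hbeta1 : 0 < beta1) (hbeta2 : 0 < beta2) (halphaA : 0 < alphaA) :
  (forall alphaN : R, 0 <= alphaN ->
     1 - (INR N ^ 2 - INR N) * alphaA ^ 2 * INR M * beta2 > 0 ->
     (SNR_NCR M P sigma2 beta1 beta2 alphaN
        >= SNR_ARIS M N P sigma2 beta1 beta2 alphaA
      <->
      alphaN >= alphaA * INR N
                / sqrt (1 - (INR N ^ 2 - INR N) * alphaA ^ 2 * INR M * beta2)))
  /\
  ((INR N ^ 2 - INR N) * alphaA ^ 2 * INR M * beta2 >= 1 ->
   forall alphaN : R, 0 <= alphaN ->
     SNR_ARIS M N P sigma2 beta1 beta2 alphaA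
       > SNR_NCR M P sigma2 beta1 beta2 alphaN).
Proof.
assert (hc : 0 < alphaA * INR N).
{ apply Rmult_lt_0_compat; [assumption | now apply lt_0_INR]. }
split.
- intros alphaN hx hD.
  rewrite Rge_div_sqrt by lra.
  destruct (SNR_diff M N P sigma2 beta1 beta2 alphaN alphaA) as [K [hK E]];
    try assumption.
  (* By [E], both directions amount to scaling an inequality by [K > 0]. *)
  split; intro H.
  + apply (Rmult_le_reg_l K); lra.
  + apply (Rmult_le_compat_l K) in H; lra.
- intros hD alphaN hx.
  destruct (SNR_diff M N P sigma2 beta1 beta2 alphaN alphaA) as [K [hK E]];
    try assumption.
  (* The square of [alphaA * N] supplies the strictness: the other term, nonnegative by [hneg],
     vanishes when [alphaN = 0] or when [hD] is an equality. *)
  pose proof (pow_lt _ 2 hc) as hc2.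
  pose proof (Rmult_le_pos _ _ (pow2_ge_0 alphaN)
    (Rge_le _ _ (Rge_minus _ _ hD))) as hneg.
  assert (H : 0 < K * ((alphaA * INR N) ^ 2 - alphaN ^ 2
    * (1 - (INR N ^ 2 - INR N) * alphaA ^ 2 * INR M * beta2))).
  { apply Rmult_lt_0_compat; lra. }
  lra.
Qed.
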